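(* Let $q\leqslant n+1$. For any nonzero $\psi=(F,G)\in\mathcal H_{\mathbf d}[q\,;\,s]$, $\kappa_*(\psi)\leqslant\dfrac{\|\psi\|}{d(\psi,\Sigma_* )}$, where distance and norm are those induced by the Weyl inner product.
   Context: $\mathcal H_{\mathbf d}[q]$: $q$-tuples of real homogeneous polynomials in $X_0,\dots,X_n$ of degrees $d_1,\dots,d_q$ with the Weyl inner product ($\langle h,h'\rangle=\sum_{|a|=d}\binom{d}{a}^{-1}h_ah'_a$ for degree-$d$ forms with coefficients $h_a,h'_a$, $\binom da$ multinomial; summed over components). $\mathcal H_{\mathbf d}[q\,;\,s]$: pairs $(F,G)$ with $F$ a $q$-tuple and $G$ an $s$-tuple, i.e. $\mathcal H_{\mathbf d}[q+s]$. For $F\in\mathcal H_{\mathbf d}[q]$, $x\in\mathbb S^n$: $T_x=\{x\}^\perp$, $\Delta=\mathrm{diag}(\sqrt{d_i})$, $\mu_{\mathrm{proj}}(F,x)=\|F\|\,\|(\mathrm DF(x)|_{T_x})^\dagger\Delta\|$ if $\mathrm DF(x)|_{T_x}$ surjective, else $\infty$; $\kappa(F,x)=(\mu_{\mathrm{proj}}(F,x)^{-2}+\|F(x)\|^2/\|F\|^2)^{-1/2}$ (conventions $\infty^{-1}=0$, $0^{-1}=\infty$, $\kappa(0,x)=\infty$); $\kappa(F)=\max_{x\in\mathbb S^n}\kappa(F,x)$. For a subtuple $L$ of $G$, $F^L$ is $F$ with the polynomials of $L$ appended. $\kappa_*(F,G)=\max\{\kappa(F^L):L\subseteq G,\ q+|L|\leq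 n+1\}$, and $\Sigma_*=\{\psi\in\mathcal H_{\mathbf d}[q\,;\,s]:\kappa_*(\psi)=\infty\}$. *)

(* Defs.v *)
From HB Require Import structures.
From mathcomp Require Import all_boot all_order all_algebra.
From mathcomp Require Import mpoly.
(* mpoly must be imported BEFORE the analysis files (notation-level clash otherwise) *)
From mathcomp Require Import boolp classical_sets reals constructive_ereal ereal.

Set Implicit Arguments.
Unset Strict Implicit.
Unset Printing Implicit Defensive.

Import Order.TTheory GRing.Theory Num.Theory.
Local Open Scope ring_scope.
Local Open Scope classical_set_scope.

Notation rpoly R n := (mpoly.mpoly n.+1 R).

Definition is_form (R : realType) (n d : nat) (p : rpoly R n) : bool :=
  p \is @mpoly.ishomog1 n.+1 R d (mpoly.mpoly_mdeg__canonical__mpoly_Measure n.+1).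

Definition in_H (R : realType) (n m : nat) (d : 'I_m -> nat)
  (F : 'I_m -> rpoly R n) : Prop := forall i, is_form (d i) (F i).

Definition multinom_coef (R : realType) (N : nat) (a : mpoly.multinom N) : R :=
  ((mpoly.mdeg a)`!)%:R / (\prod_(i < N) (mpoly.fun_of_multinom a i)`!)%:R.

(** Weyl squared norm of one form: sum_a binom(d,a)^{-1} h_a^2
    (for a form of degree d every monomial a of its support has |a| = d). *)
Definition weyl_sq (R : realType) (n : nat) (p : rpoly R n) : R :=
  \sum_(a <- mpoly.msupp p) (mpoly.mcoeff a p) ^+ 2 / multinom_coef R a.

Definition weyl_norm (R : realType) (n m : nat) (F : 'I_m -> rpoly R n) : R :=
  Num.sqrt (\sum_(i < m) weyl_sq (F i)).

Definition weyl_norm2 (R : realType) (n q s : nat)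
  (F : 'I_q -> rpoly R n) (G : 'I_s -> rpoly R n) : R :=
  Num.sqrt (\sum_(i < q) weyl_sq (F i) + \sum_(j < s) weyl_sq (G j)).

Definition enorm (R : realType) (k : nat) (v : 'cV[R]_k) : R :=
  Num.sqrt (\sum_(i < k) v i 0 ^+ 2).

Definition opnorm (R : realType) (k l : nat) (M : 'M[R]_(k, l)) : R :=
  sup [set enorm (M *m w) | w in [set w : 'cV[R]_l | enorm w <= 1]].

Definition evalF (R : realType) (n m : nat) (F : 'I_m -> rpoly R n)
  (x : 'cV[R]_n.+1) : 'cV[R]_m :=
  \col_i mpoly.meval (fun k => x k 0) (F i).

Definition jac (R : realType) (n m : nat) (F : 'I_m -> rpoly R n)
  (x : 'cV[R]_n.+1) : 'M[R]_(m, n.+1) :=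
  \matrix_(i, k) mpoly.meval (fun j => x j 0) (mpoly.mderiv k (F i)).

Definition in_tangent (R : realType) (n : nat) (x v : 'cV[R]_n.+1) : Prop :=
  \sum_(k < n.+1) x k 0 * v k 0 = 0.

Definition restr_surj (R : realType) (n m : nat) (F : 'I_m -> rpoly R n)
  (x : 'cV[R]_n.+1) : Prop :=
  forall w : 'cV[R]_m, exists v, in_tangent x v /\ jac F x *m v = w.

Definition Delta (R : realType) (m : nat) (d : 'I_m -> nat) : 'M[R]_m :=
  diag_mx (\row_i Num.sqrt ((d i)%:R)).

(** (DF(x)|_{T_x})^† Delta, as a matrix R^m -> R^{n+1} (with values in T_x),
    for x a unit vector and DF(x)|_{T_x} surjective: with P = I - x x^T the
    orthogonal projector onto T_x, the adjoint adj(A) of A := DF(x)|_{T_x} is P J^T and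
    A^† = adj(A) (A adj(A))^{-1} = P J^T (J P J^T)^{-1}. *)
Definition pinv_Delta (R : realType) (n m : nat) (d : 'I_m -> nat)
  (F : 'I_m -> rpoly R n) (x : 'cV[R]_n.+1) : 'M[R]_(n.+1, m) :=
  let J := jac F x in
  let P := 1%:M - x *m x^T in
  P *m J^T *m invmx (J *m P *m J^T) *m Delta R d.

Definition mu_proj (R : realType) (n m : nat) (d : 'I_m -> nat)
  (F : 'I_m -> rpoly R n) (x : 'cV[R]_n.+1) : \bar R :=
  if `[< restr_surj F x >] then (weyl_norm F * opnorm (pinv_Delta d F x))%:E
  else +oo%E.

Definition einv (R : realType) (e : \bar R) : \bar R :=
  match e with
  | r%:E => if r == 0 then +oo%E else (r^-1)%:E
  | _ => 0%E
  end.

Definition esqrt (R : realType) (e : \bar R) : \bar R :=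
  match e with
  | r%:E => (Num.sqrt r)%:E
  | +oo%E => +oo%E
  | -oo%E => 0%E
  end.

Definition kappa_at (R : realType) (n m : nat) (d : 'I_m -> nat)
  (F : 'I_m -> rpoly R n) (x : 'cV[R]_n.+1) : \bar R :=
  if `[< forall i, F i = 0 >] then +oo%E
  else
    let mi := einv (mu_proj d F x) in
    einv (esqrt (mi * mi +
                 ((enorm (evalF F x)) ^+ 2 / (weyl_norm F) ^+ 2)%:E)%E).

Definition kappa (R : realType) (n m : nat) (d : 'I_m -> nat)
  (F : 'I_m -> rpoly R n) : \bar R :=
  ereal_sup [set kappa_at d F x | x in [set x : 'cV[R]_n.+1 | enorm x = 1]].

Definition append (T : Type) (q s : nat) (F : 'I_q -> T) (G : 'I_s -> T)
  (S : {set 'I_s}) : 'I_(q + #|S|) -> T :=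
  fun k => match split k with
           | inl i => F i
           | inr j => G (enum_val j)
           end.
Arguments append {T q s} F G S _.

Definition kappa_star (R : realType) (n q s : nat)
  (dF : 'I_q -> nat) (dG : 'I_s -> nat)
  (F : 'I_q -> rpoly R n) (G : 'I_s -> rpoly R n) : \bar R :=
  ereal_sup [set kappa (append dF dG S) (append F G S)
            | S in [set S : {set 'I_s} | (q + #|S| <= n.+1)%N]].

Definition Sigma_star (R : realType) (n q s : nat)
  (dF : 'I_q -> nat) (dG : 'I_s -> nat) :
  set (('I_q -> rpoly R n) * ('I_s -> rpoly R n)) :=
  [set FG | in_H dF FG.1 /\ in_H dG FG.2 /\
            kappa_star dF dG FG.1 FG.2 = +oo%E].

Definition dist_Sigma_star (R : realType) (n q s : nat)
  (dF : 'I_q -> nat) (dG : 'I_s -> nat)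
  (F : 'I_q -> rpoly R n) (G : 'I_s -> rpoly R n) : R :=
  inf [set weyl_norm2 (fun i => F i - FG.1 i) (fun j => G j - FG.2 j)
      | FG in Sigma_star dF dG].

Definition eratio (R : realType) (a b : R) : \bar R :=
  if b == 0 then +oo%E else (a / b)%:E.

(* Main.v *)
(** Fix a subset S of the inequalities and a unit vector x, let H = F^S, A =
    DH(x)|_{T_x}, and suppose A is onto. For |z| <= 1 put y = A^dagger Delta z.
    Subtracting from each H_i the form
      H_i(x) <x,X>^d_i + sqrt(d_i) u_i <x,X>^(d_i - 1) <y,X>
    makes H vanish at x and, for a suitable vector u with |u| <= 1 / |y|^2,
    makes its derivative on T_x miss a direction: the new system lies in
    Sigma_*. The powers of <x,X> reproduce values and derivatives at x for the
    Weyl product, so the squared size of this change is at most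
    |H(x)|^2 + |y|^-2. Taking the infimum over z, the distance of psi to
    Sigma_* satisfies
      dist(psi)^2 <= |H(x)|^2 + ||A^dagger Delta||^-2
                   = (||H|| / kappa(H, x))^2.
    If A is not onto, the first term of the change alone suffices. *)
Require Import Defs.
From HB Require Import structures.
From mathcomp Require Import all_boot all_order all_algebra.
From mathcomp Require Import mpoly.
From mathcomp Require Import boolp classical_sets reals constructive_ereal ereal.
From mathcomp Require Import ring.

Set Implicit Arguments.
Unset Strict Implicit.
Unset Printing Implicit Defensive.

Import Order.TTheory GRing.Theory Num.Theory.
Local Open Scope ring_scope.

(** * The Weyl inner product and multiplication by a variable *)

(** Summing over all monomials of degree below a fixed [K], rather than over supports, makes
    bilinearity termwise. *)
Definition weyl_ip (R : realType) (n K : nat) (p q : rpoly R n) : R :=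
  \sum_(a : 'X_{1..n.+1 < K}) p@_a * q@_a / multinom_coef R a.

Definition linform (R : realType) (n : nat) (x : 'cV[R]_n.+1) : rpoly R n :=
  \sum_k x k 0 *: 'X_k.

Definition dot (R : realType) (k : nat) (u v : 'cV[R]_k) : R :=
  \sum_i u i 0 * v i 0.

(** Passing from a to a + e_i multiplies |a|! by |a| + 1 and a_i! by a_i + 1. *)
Lemma multinom_coefDU (R : realType) (N : nat) (a : 'X_{1..N}) (i : 'I_N) :
  (multinom_coef R (a + U_(i))%MM)^-1
  = (a i).+1%:R / (mdeg a).+1%:R * (multinom_coef R a)^-1.
Proof.
rewrite /multinom_coef !invf_div mdegD mdeg1 addn1 factS.
rewrite (bigD1 i) //= [in RHS](bigD1 i) //= mnmDE mnm1E eqxx addn1 factS.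
rewrite (eq_bigr (fun j => (a j)`!)) => [|j /negPf ji]; last first.
  by rewrite mnmDE mnm1E eq_sym ji addn0.
rewrite -mulnA natrM [((mdeg a).+1 * _)%:R]natrM invfM; ring.
Qed.

Lemma weyl_sqE (R : realType) (n K : nat) (p : rpoly R n) :
  (msize p <= K)%N -> weyl_sq p = weyl_ip K p p.
Proof.
move=> le_pK; rewrite /weyl_sq /weyl_ip.
rewrite (ssrcomplements.big_mksub 'X_{1..n.+1 < K}) //=.
- rewrite big_rmcond //= => a /memN_msupp_eq0 ->; by rewrite expr0n mul0r.
- exact: msupp_uniq.
- by move=> a /msize_mdeg_lt /leq_trans; apply.
Qed.

Lemma weyl_ipDl (R : realType) (n K : nat) (p1 p2 q : rpoly R n) :
  weyl_ip K (p1 + p2) q = weyl_ip K p1 q + weyl_ip K p2 q.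
Proof. by rewrite -big_split; apply: eq_bigr => a _; rewrite mcoeffD !mulrDl. Qed.

Lemma weyl_ipZl (R : realType) (n K : nat) c (p q : rpoly R n) :
  weyl_ip K (c *: p) q = c * weyl_ip K p q.
Proof. by rewrite mulr_sumr; apply: eq_bigr => a _; rewrite mcoeffZ !mulrA. Qed.

Lemma weyl_ip_suml (R : realType) (n K : nat) (I : Type) (r : seq I)
    (f : I -> rpoly R n) (q : rpoly R n) :
  weyl_ip K (\sum_(i <- r) f i) q = \sum_(i <- r) weyl_ip K (f i) q.
Proof.
elim: r => [|i r IH]; last by rewrite !big_cons weyl_ipDl IH.
by rewrite !big_nil /weyl_ip big1 // => a _; rewrite mcoeff0 !mul0r.
Qed.

Lemma weyl_ip_monomial (R : realType) (n K : nat) (a : 'X_{1..n.+1})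
    (q : rpoly R n) :
  (mdeg a < K)%N -> weyl_ip K 'X_[a] q = q@_a / multinom_coef R a.
Proof.
move=> aK; rewrite /weyl_ip (bigD1 (BMultinom aK)) //= mcoeffX eqxx mul1r.
rewrite big1 ?addr0 // => b ba; rewrite mcoeffX.
by case: eqP => [ab|_]; [case/eqP: ba; apply: val_inj | rewrite !mul0r].
Qed.

(** Checked on each monomial X^a of [p]: the derivative brings the factor a_i + 1, which is the one
    in [multinom_coefDU]. Multiplication by X_i is thus adjoint to a multiple of the derivative. *)
Lemma weyl_ip_mulX (R : realType) (n K d : nat) (i : 'I_n.+1) (p q : rpoly R n) :
  p \is d.-homog -> (d.+1 < K)%N ->
  weyl_ip K ('X_i * p) q = d.+1%:R^-1 * weyl_ip K p q^`M(i).
Proof.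
move=> /dhomogP hp dK; rewrite [p]mpolyE mulr_sumr !weyl_ip_suml mulr_sumr.
apply: eq_big_seq => a /hp /= da.
rewrite -scalerAr -mpolyXD addmC !weyl_ipZl.
rewrite !weyl_ip_monomial ?mdegD ?mdeg1 ?da ?addn1 ?(ltnW dK) //.
rewrite mcoeff_mderiv multinom_coefDU da -mulr_natr; ring.
Qed.

(** * Euler's identity and the reproducing property of powers of linear forms *)

Lemma dhomog_mderiv (R : realType) (n d : nat) (i : 'I_n.+1) (p : rpoly R n) :
  p \is d.+1.-homog -> p^`M(i) \is d.-homog.
Proof.
move=> /dhomogP hp; apply/dhomogP => a; rewrite mcoeff_msupp mcoeff_mderiv => nz.
have /hp : (a + U_(i))%MM \in msupp p.
  by rewrite mcoeff_msupp; apply: contraNneq nz => ->; rewrite mul0rn.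
by rewrite /= mdegD mdeg1 addn1 => -[].
Qed.

Lemma euler_homog (R : realType) (n d : nat) (p : rpoly R n) (v : 'I_n.+1 -> R) :
  p \is d.-homog -> \sum_k v k * p^`M(k).@[v] = d%:R * p.@[v].
Proof.
move=> /dhomogP hp; rewrite mevalE mulr_sumr /mderiv.
under eq_bigr => k _ do rewrite raddf_sum mulr_sumr.
rewrite exchange_big /=; apply: eq_big_seq => a /hp /= da.
rewrite -{}da mdegE natr_sum mulr_suml; apply: eq_bigr => k _ /=.
rewrite mevalZ mevalX.
rewrite [in RHS](bigD1 k) //= (bigD1 k) //= mnmBE mnm1E eqxx.
rewrite (eq_bigr (fun j => v j ^+ a j)) => [|j /negPf jk]; last first.
  by rewrite mnmBE mnm1E eq_sym jk subn0.
(* At a_k = 0 the truncated exponent a - e_k is meaningless, but its coefficient is 0. *)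
case: (a k) => [|b]; first by rewrite !mul0r !mulr0.
rewrite subn1 exprS /=; ring.
Qed.

Lemma weyl_ip_linform (R : realType) (n K d : nat) (x : 'cV[R]_n.+1)
    (p q : rpoly R n) :
  p \is d.-homog -> (d.+1 < K)%N ->
  weyl_ip K (linform x * p) q
  = d.+1%:R^-1 * \sum_k x k 0 * weyl_ip K p q^`M(k).
Proof.
move=> hp dK; rewrite mulr_suml weyl_ip_suml mulr_sumr; apply: eq_bigr => k _.
by rewrite -scalerAl weyl_ipZl (weyl_ip_mulX _ _ hp dK); ring.
Qed.

Lemma dhomog_linform (R : realType) (n : nat) (x : 'cV[R]_n.+1) :
  linform x \is 1.-homog.
Proof.
by apply: rpred_sum => k _; apply: rpredZ; rewrite dhomogX /= mdeg1.
Qed.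

Lemma dhomog_linformX (R : realType) (n d : nat) (x : 'cV[R]_n.+1) :
  linform x ^+ d \is d.-homog.
Proof. by have := dhomogMn d (dhomog_linform x); rewrite mul1n. Qed.

(** Induction on [d]: one factor [linform x] moves to the other side as the derivative along x
    divided by the degree, the induction hypothesis evaluates it at x, and Euler's identity gives
    back q(x). *)
Lemma weyl_ip_linformX (R : realType) (n K d : nat) (x : 'cV[R]_n.+1)
    (q : rpoly R n) :
  q \is d.-homog -> (d < K)%N ->
  weyl_ip K (linform x ^+ d) q = q.@[fun k => x k 0].
Proof.
elim: d q => [|d IH] q hq dK.
  rewrite expr0 -mpolyX0 weyl_ip_monomial ?mdeg0 //.
  have -> : q = (q@_0%MM)%:MP.
    apply/mpolyP => a; rewrite mcoeffC; case: eqVneq => [->|a0].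
      by rewrite mulr1.
    by rewrite mulr0 (dhomog_nemf_coeff hq) //= mdeg_eq0.
  rewrite mevalC mcoeffC eqxx /multinom_coef mdeg0 big1 => [|k _].
    by rewrite fact0 divr1 divr1 mulr1.
  by rewrite mnm0E.
rewrite exprS (weyl_ip_linform _ _ (dhomog_linformX _ _) dK).
under eq_bigr => k _ do rewrite IH ?dhomog_mderiv ?(ltnW dK) //.
by rewrite (euler_homog _ hq) mulKf // pnatr_eq0.
Qed.

(** * Values, derivatives and Weyl norm of the peak forms *)

Lemma meval_linform (R : realType) (n : nat) (x v : 'cV[R]_n.+1) :
  (linform x).@[fun k => v k 0] = dot x v.
Proof.
by rewrite /linform raddf_sum /=; apply: eq_bigr => k _; rewrite mevalZ mevalXU.
Qed.

Lemma mderiv_linform (R : realType) (n : nat) (x : 'cV[R]_n.+1) k :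
  (linform x)^`M(k) = (x k 0)%:MP.
Proof.
rewrite /linform raddf_sum (bigD1 k) //= big1 => [|j /negPf jk]; last first.
  by rewrite mderivZ mderivX mnm1E jk scale0r scaler0.
rewrite mderivZ mderivX mnm1E eqxx scale1r addr0 -mul_mpolyC.
have -> : (U_(k) - U_(k))%MM = 0%MM.
  by apply/mnmP => j; rewrite mnmBE mnm0E subnn.
by rewrite mpolyX0 mulr1.
Qed.

Lemma meval_linformX (R : realType) (n d : nat) (x : 'cV[R]_n.+1) :
  dot x x = 1 -> (linform x ^+ d).@[fun k => x k 0] = 1.
Proof. by move=> x1; rewrite rmorphXn /= meval_linform x1 expr1n. Qed.

Lemma meval_mderiv_linformX (R : realType) (n d : nat) (x : 'cV[R]_n.+1) k :
  dot x x = 1 ->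
  ((linform x ^+ d)^`M(k)).@[fun j => x j 0] = d%:R * x k 0.
Proof.
move=> x1; elim: d => [|d IH].
  by rewrite expr0 mderivC meval0 mul0r.
rewrite exprS mderivM mevalD !mevalM IH mderiv_linform mevalC.
rewrite meval_linformX // meval_linform x1 -natr1; ring.
Qed.

(* For x of norm 1 and w orthogonal to x, this is the form of least Weyl norm
   with value c at x and derivative sqrt(d) u w along the tangent space. At
   d = 0 the truncated exponent is harmless, sqrt(d) being 0. *)
Definition peak (R : realType) (n d : nat) (x w : 'cV[R]_n.+1) (c u : R) :
    rpoly R n :=
  c *: linform x ^+ d
  + (Num.sqrt d%:R * u) *: (linform w * linform x ^+ d.-1).

Lemma dhomog_peak (R : realType) (n d : nat) (x w : 'cV[R]_n.+1) (c u : R) :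
  peak d x w c u \is d.-homog.
Proof.
apply: rpredD; first by apply: rpredZ; apply: dhomog_linformX.
case: d => [|d]; first by rewrite sqrtr0 mul0r scale0r rpred0.
apply: rpredZ; rewrite -[d.+1]add1n.
exact: dhomogM (dhomog_linform w) (dhomog_linformX _ _).
Qed.

Lemma meval_peak (R : realType) (n d : nat) (x w : 'cV[R]_n.+1) (c u : R) :
  dot x x = 1 -> dot w x = 0 -> (peak d x w c u).@[fun k => x k 0] = c.
Proof.
move=> x1 wx; rewrite mevalD !mevalZ mevalM meval_linform wx.
by rewrite meval_linformX // mul0r !mulr0 addr0 mulr1.
Qed.

(** At x the factor [linform w] vanishes, so in the second term only its own derivative survives.
    The first term contributes a multiple of x, normal to the tangent space. *)
Lemma meval_mderiv_peak (R : realType) (n d : nat) (x w : 'cV[R]_n.+1)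
    (c u : R) k :
  dot x x = 1 -> dot w x = 0 ->
  ((peak d x w c u)^`M(k)).@[fun j => x j 0]
  = c * d%:R * x k 0 + Num.sqrt d%:R * u * w k 0.
Proof.
move=> x1 wx; rewrite mderivD !mderivZ mevalD !mevalZ mderivM mevalD !mevalM.
rewrite meval_linform wx mderiv_linform mevalC meval_mderiv_linformX //.
by rewrite meval_linformX //; ring.
Qed.

(** Applying the reproducing property to one side of <p,p> leaves the value of [p] at x and its
    derivative along w. The factor 1/d cancels sqrt(d)^2. Equality can fail only at d = 0, where the
    second term vanishes. *)
Lemma weyl_sq_peak (R : realType) (n d : nat) (x w : 'cV[R]_n.+1) (c u : R) :
  dot x x = 1 -> dot w x = 0 ->
  weyl_sq (peak d x w c u) <= c ^+ 2 + u ^+ 2 * dot w w.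
Proof.
move=> x1 wx; set p := peak d x w c u.
have hp : p \is d.-homog := dhomog_peak d x w c u.
have w0 : 0 <= dot w w by apply: sumr_ge0 => k _; rewrite -expr2 sqr_ge0.
have size_p : (msize p <= d.+1)%N.
  rewrite msizeE big_seq; apply/bigmax_leqP_seq => a ap _.
  by rewrite (dhomogP _ _ _ hp _ ap).
rewrite (weyl_sqE size_p) {1}/p /peak weyl_ipDl !weyl_ipZl.
rewrite weyl_ip_linformX // meval_peak //.
case: d @p hp size_p => [|d] p hp size_p.
  by rewrite sqrtr0 !mul0r addr0 -expr2 lerDl mulr_ge0 // sqr_ge0.
rewrite (weyl_ip_linform _ _ (dhomog_linformX d x)) //=.
under eq_bigr => k _ do
  rewrite weyl_ip_linformX ?dhomog_mderiv // /p meval_mderiv_peak //.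
rewrite le_eqVlt; apply/orP; left; apply/eqP; rewrite -expr2; congr (_ + _).
under eq_bigr => k _.
  have -> : w k 0 * (c * d.+1%:R * x k 0 + Num.sqrt d.+1%:R * u * w k 0)
          = c * d.+1%:R * (w k 0 * x k 0) + Num.sqrt d.+1%:R * u * (w k 0 * w k 0)
    by ring.
  over.
rewrite big_split /= -!mulr_sumr -/(dot w x) -/(dot w w) wx mulr0 add0r.
transitivity (Num.sqrt d.+1%:R ^+ 2 * d.+1%:R^-1 * (u ^+ 2 * dot w w)).
  ring.
by rewrite sqr_sqrtr ?ler0n // divff ?mul1r // pnatr_eq0.
Qed.

(** * Euclidean dot product and the Moore-Penrose inverse *)

Lemma mulmx_tr_dot (R : realType) (k : nat) (u v : 'cV[R]_k) :
  u^T *m v = (dot u v)%:M.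
Proof.
by rewrite [LHS]mx11_scalar mxE; congr _%:M; apply: eq_bigr => i _; rewrite mxE.
Qed.

Lemma dot0l (R : realType) (k : nat) (v : 'cV[R]_k) : dot 0 v = 0.
Proof. by apply: big1 => i _; rewrite mxE mul0r. Qed.

Lemma dotC (R : realType) (k : nat) (u v : 'cV[R]_k) : dot u v = dot v u.
Proof. by apply: eq_bigr => i _; rewrite mulrC. Qed.

Lemma dotBr (R : realType) (k : nat) (u v w : 'cV[R]_k) :
  dot u (v - w) = dot u v - dot u w.
Proof. by rewrite -sumrB; apply: eq_bigr => i _; rewrite !mxE mulrBr. Qed.

Lemma dotZr (R : realType) (k : nat) a (u v : 'cV[R]_k) :
  dot u (a *: v) = a * dot u v.
Proof. by rewrite mulr_sumr; apply: eq_bigr => i _; rewrite mxE mulrCA. Qed.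

Lemma dot_mull (R : realType) (k l : nat) (A : 'M[R]_(k, l)) u v :
  dot (A *m u) v = dot u (A^T *m v).
Proof.
have E (a b : R) : a%:M = b%:M :> 'M_1 -> a = b.
  by move=> /matrixP/(_ 0 0); rewrite !mxE eqxx.
by apply: E; rewrite -!mulmx_tr_dot trmx_mul -mulmxA.
Qed.

Lemma dot_ge0 (R : realType) (k : nat) (u : 'cV[R]_k) : 0 <= dot u u.
Proof. by apply: sumr_ge0 => i _; rewrite -expr2 sqr_ge0. Qed.

Lemma dot_eq0 (R : realType) (k : nat) (u : 'cV[R]_k) :
  (dot u u == 0) = (u == 0).
Proof.
rewrite psumr_eq0 => [|i _]; last by rewrite -expr2 sqr_ge0.
apply/allP/eqP => [u0|-> i _]; last by rewrite mxE mul0r eqxx.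
apply/colP => i; rewrite mxE; apply/eqP.
by have := u0 i (mem_index_enum i); rewrite mulf_eq0 orbb.
Qed.

Lemma enormE (R : realType) (k : nat) (u : 'cV[R]_k) :
  enorm u = Num.sqrt (dot u u).
Proof. by []. Qed.

Lemma sqr_enorm (R : realType) (k : nat) (u : 'cV[R]_k) :
  enorm u ^+ 2 = dot u u.
Proof. by rewrite enormE sqr_sqrtr // dot_ge0. Qed.

Lemma cauchy_schwarz_dot (R : realType) (k : nat) (u v : 'cV[R]_k) :
  dot u v ^+ 2 <= dot u u * dot v v.
Proof.
have [u0|un0] := eqVneq u 0.
  by rewrite u0 !dot0l mul0r expr0n /= lexx.
have uu : 0 < dot u u by rewrite lt_neqAle eq_sym dot_eq0 un0 dot_ge0.
(* The square norm of this vector is |u|^2 (|u|^2 |v|^2 - <u,v>^2). *)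
have := dot_ge0 (dot u u *: v - dot u v *: u).
rewrite dotBr !dotZr !(dotC (_ - _)) !dotBr !dotZr (dotC v u).
set a := dot u u in uu *; set b := dot u v; set c := dot v v => h.
have {}h : 0 <= a * (a * c - b ^+ 2).
  by apply: le_trans h _; rewrite le_eqVlt; apply/orP; left; apply/eqP; ring.
by rewrite -subr_ge0 -(pmulr_rge0 _ uu).
Qed.

(* With P the projector onto the tangent space and G = J P J^T, the witness
   is zeta = G^-1 Delta z; it is a covector on the target pulling back along
   DF(x)|_{T_x} to y = (DF(x)|_{T_x})^dagger Delta z. *)
Lemma pinv_Delta_dual (R : realType) (n m : nat) (d : 'I_m -> nat)
    (F : 'I_m -> rpoly R n) (x : 'cV[R]_n.+1) (z : 'cV[R]_m) :
  dot x x = 1 -> restr_surj F x ->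
  let y := pinv_Delta d F x *m z in
  exists zeta : 'cV[R]_m,
    [/\ dot y x = 0,
        forall v, in_tangent x v -> dot zeta (jac F x *m v) = dot y v
      & dot y y = dot (Delta R d *m zeta) z].
Proof.
move=> x1 surj; rewrite /pinv_Delta.
set J := jac F x; set P := 1%:M - _; set D := Delta R d.
have tP : P^T = P by rewrite /P linearB /= trmx1 trmx_mul trmxK.
have Pv v : in_tangent x v -> P *m v = v.
  move=> xv; rewrite mulmxBl mul1mx -mulmxA mulmx_tr_dot [dot x v]xv.
  by rewrite mul_mx_scalar scale0r subr0.
have Px : P *m x = 0.
  by rewrite mulmxBl mul1mx -mulmxA mulmx_tr_dot x1 mulmx1 subrr.
have PP : P *m P = P.
  by rewrite {2}/P mulmxBr mulmx1 mulmxA Px mul0mx subr0.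
have tG : (J *m P *m J^T)^T = J *m P *m J^T.
  by rewrite !trmx_mul trmxK tP mulmxA.
have tD : D^T = D by rewrite tr_diag_mx.
(* A kernel vector r of this Gram matrix has |P J^T r|^2 = 0; writing r = J v with v tangent gives
   |r|^2 = <v, P J^T r> = 0. Hence [invmx] is a true inverse here. *)
have Gu : J *m P *m J^T \in unitmx.
  rewrite -row_free_unit; apply: inj_row_free => r rG.
  have G0 : J *m P *m J^T *m r^T = 0.
    by rewrite -[X in X *m _]tG -trmx_mul rG trmx0.
  have : dot (P *m (J^T *m r^T)) (P *m (J^T *m r^T)) = 0.
    rewrite dot_mull tP mulmxA PP (dot_mull J^T) trmxK !mulmxA G0.
    by rewrite dotC dot0l.
  move/eqP; rewrite dot_eq0 => /eqP PJ0.
  have [v [xv Jv]] := surj r^T.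
  apply: trmx_inj; apply/eqP; rewrite trmx0 -dot_eq0 -{2}Jv.
  rewrite dotC dot_mull -(Pv _ xv) dot_mull tP PJ0.
  by rewrite dotC dot0l.
pose zeta := invmx (J *m P *m J^T) *m D *m z; exists zeta.
have -> : P *m J^T *m invmx (J *m P *m J^T) *m D *m z = P *m (J^T *m zeta).
  by rewrite /zeta !mulmxA.
have : J *m P *m J^T *m zeta = D *m z.
  by rewrite /zeta !mulmxA mulmxV // mul1mx.
move: zeta => zeta Gzeta; split=> [|v xv|].
- by rewrite dot_mull tP Px dotC dot0l.
- by rewrite dot_mull tP (Pv _ xv) dot_mull trmxK.
rewrite (dot_mull P) tP mulmxA PP (dot_mull J^T) trmxK !mulmxA Gzeta.
by rewrite dot_mull tD.
Qed.

(** * Perturbations that make x a singular zero *)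

(** The heights are the values of [F] at x, so that subtraction makes x a zero; [w] and [u] remain
    free to steer the derivative. *)
Definition peaks (R : realType) (n m : nat) (d : 'I_m -> nat)
    (F : 'I_m -> rpoly R n) (x w : 'cV[R]_n.+1) (u : 'cV[R]_m) (i : 'I_m) :=
  peak (d i) x w (evalF F x i 0) (u i 0).

Lemma in_H_peaks (R : realType) (n m : nat) (d : 'I_m -> nat)
    (F : 'I_m -> rpoly R n) (x w : 'cV[R]_n.+1) (u : 'cV[R]_m) :
  in_H d (peaks d F x w u).
Proof. by move=> i; apply: dhomog_peak. Qed.

Lemma weyl_sq_peaks (R : realType) (n m : nat) (d : 'I_m -> nat)
    (F : 'I_m -> rpoly R n) (x w : 'cV[R]_n.+1) (u : 'cV[R]_m) :
  dot x x = 1 -> dot w x = 0 ->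
  \sum_i weyl_sq (peaks d F x w u i)
  <= enorm (evalF F x) ^+ 2 + dot u u * dot w w.
Proof.
move=> x1 wx; rewrite sqr_enorm mulr_suml -big_split; apply: ler_sum => i _ /=.
by rewrite -!expr2; apply: weyl_sq_peak.
Qed.

Lemma evalF_sub_peaks (R : realType) (n m : nat) (d : 'I_m -> nat)
    (F : 'I_m -> rpoly R n) (x w : 'cV[R]_n.+1) (u : 'cV[R]_m) :
  dot x x = 1 -> dot w x = 0 ->
  evalF (fun i => F i - peaks d F x w u i) x = 0.
Proof.
move=> x1 wx; apply/colP => i; rewrite !mxE mevalB /peaks meval_peak // mxE.
by rewrite subrr.
Qed.

(** Radial terms vanish on tangent vectors, which leaves a correction of rank at most one. *)
Lemma jac_sub_peaks (R : realType) (n m : nat) (d : 'I_m -> nat)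
    (F : 'I_m -> rpoly R n) (x w v : 'cV[R]_n.+1) (u : 'cV[R]_m) :
  dot x x = 1 -> dot w x = 0 -> in_tangent x v ->
  jac (fun i => F i - peaks d F x w u i) x *m v
  = jac F x *m v - dot w v *: (Delta R d *m u).
Proof.
move=> x1 wx xv; apply/colP => i; rewrite mul_diag_mx !mxE.
under eq_bigr => k _.
  rewrite mxE mderivB mevalB /peaks meval_mderiv_peak // mulrBl.
  set e := evalF F x i 0.
  have -> : (e * (d i)%:R * x k 0 + Num.sqrt (d i)%:R * u i 0 * w k 0) * v k 0
    = e * (d i)%:R * (x k 0 * v k 0)
      + Num.sqrt (d i)%:R * u i 0 * (w k 0 * v k 0) by ring.
  over.
rewrite sumrB big_split /= -!mulr_sumr xv mulr0 add0r -/(dot w v).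
congr (_ - _); last by rewrite mulrC.
by apply: eq_bigr => k _; rewrite mxE.
Qed.

Lemma kappa_at_singular (R : realType) (n m : nat) (d : 'I_m -> nat)
    (F : 'I_m -> rpoly R n) (x : 'cV[R]_n.+1) :
  evalF F x = 0 -> ~ restr_surj F x -> kappa_at d F x = +oo%E.
Proof.
move=> Fx nsurj; rewrite /kappa_at; case: ifP => // _.
rewrite /mu_proj asboolF //= sqr_enorm Fx.
by rewrite dot0l !mul0r addr0 sqrtr0 eqxx.
Qed.

(** With [w] and [u] zero only the values at x are removed; the tangential derivative is unchanged
    and still not onto. *)
Lemma singular_perturbation_degenerate (R : realType) (n m : nat)
    (d : 'I_m -> nat) (F : 'I_m -> rpoly R n) (x : 'cV[R]_n.+1) :
  dot x x = 1 -> ~ restr_surj F x ->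
  exists p : 'I_m -> rpoly R n,
    [/\ in_H d p, kappa_at d (fun i => F i - p i) x = +oo%E
      & \sum_i weyl_sq (p i) <= enorm (evalF F x) ^+ 2].
Proof.
move=> x1 nsurj.
exists (peaks d F x 0 0); split; first exact: in_H_peaks.
  apply: kappa_at_singular; first by apply: evalF_sub_peaks; rewrite ?dot0l.
  apply: contra_not nsurj => surj w; have [v [xv Jv]] := surj w.
  exists v; split=> //.
  by move: Jv; rewrite jac_sub_peaks ?dot0l // mulmx0 scaler0 subr0.
apply: le_trans (weyl_sq_peaks _ _ _ x1 (dot0l _)) _.
by rewrite dot0l mul0r addr0.
Qed.

(** The slopes Delta zeta / |Delta zeta|^2 are chosen so that <zeta, J v> = <y,v> is cancelled by
    the correction: [zeta] becomes orthogonal to the image of the new derivative. *)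
Lemma singular_perturbation (R : realType) (n m : nat)
    (d : 'I_m -> nat) (F : 'I_m -> rpoly R n) (x : 'cV[R]_n.+1) (z : 'cV[R]_m) :
  dot x x = 1 -> restr_surj F x ->
  enorm z <= 1 -> 0 < enorm (pinv_Delta d F x *m z) ->
  exists p : 'I_m -> rpoly R n,
    [/\ in_H d p, kappa_at d (fun i => F i - p i) x = +oo%E
      & \sum_i weyl_sq (p i)
        <= enorm (evalF F x) ^+ 2 + enorm (pinv_Delta d F x *m z) ^- 2].
Proof.
move=> x1 surj z1; have [zeta] := pinv_Delta_dual d z x1 surj.
set y := _ *m z => -[yx zJ yy] y0.
have {}y0 : 0 < dot y y by rewrite -sqr_enorm exprn_gt0.
set u := Delta R d *m zeta in yy.
have u0 : 0 < dot u u.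
  rewrite lt_def dot_ge0 andbT dot_eq0; apply: contraTneq y0 => u0.
  by rewrite yy u0 dot0l ltxx.
exists (peaks d F x y ((dot u u)^-1 *: u)); split; first exact: in_H_peaks.
  apply: kappa_at_singular; first exact: evalF_sub_peaks.
  (* A tangent v mapped to [zeta] itself would give |zeta|^2 = 0, hence Delta zeta = 0. *)
  move=> /(_ zeta) [v [xv]]; rewrite jac_sub_peaks // => /(congr1 (dot zeta)).
  rewrite dotBr zJ // -scalemxAr !dotZr [dot zeta (Delta R d *m u)]dotC dot_mull.
  rewrite tr_diag_mx -/(Delta R d) -/u mulVf ?gt_eqF // mulr1 subrr.
  move/esym/eqP; rewrite dot_eq0 => /eqP zeta0; move: u0.
  by rewrite /u zeta0 mulmx0 dot0l ltxx.
(* The added cost is |y|^2 / |Delta zeta|^2. From |y|^2 = <Delta zeta, z>, Cauchy-Schwarz and |z| <=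
   1 follows |y|^4 <= |Delta zeta|^2, so the cost is at most |y|^-2. *)
apply: le_trans (weyl_sq_peaks _ _ _ x1 yx) _; rewrite lerD2l sqr_enorm.
rewrite dotZr (dotC _ u) dotZr mulVf ?gt_eqF // mulr1 mulrC ler_pdivrMr //.
rewrite ler_pdivlMl // -expr2 yy.
apply: le_trans (cauchy_schwarz_dot _ _) _; rewrite ler_piMr ?dot_ge0 //.
by rewrite -sqr_enorm -[1](expr1n _ 2) lerXn2r // ?nnegrE ?sqrtr_ge0.
Qed.

(** * Subtuples and the distance to Sigma_* *)

Lemma append_lshift (T : Type) (q s : nat) (F : 'I_q -> T) (G : 'I_s -> T)
    (S : {set 'I_s}) i : append F G S (lshift _ i) = F i.
Proof. by rewrite /append (unsplitK (inl i)). Qed.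

Lemma append_rshift (T : Type) (q s : nat) (F : 'I_q -> T) (G : 'I_s -> T)
    (S : {set 'I_s}) l : append F G S (rshift _ l) = G (enum_val l).
Proof. by rewrite /append (unsplitK (inr l)). Qed.

Lemma weyl_sq_ge0 (R : realType) (n : nat) (p : rpoly R n) : 0 <= weyl_sq p.
Proof.
by apply: sumr_ge0 => a _; rewrite mulr_ge0 ?sqr_ge0 // invr_ge0 divr_ge0 ?ler0n.
Qed.

Lemma weyl_sq0 (R : realType) (n : nat) : weyl_sq (0 : rpoly R n) = 0.
Proof. by rewrite /weyl_sq msupp0 big_nil. Qed.

(** Extension by zero, used to lift a perturbation of the selected polynomials to all of [G]. *)
Definition scatter (V : nmodType) (s : nat) (S : {set 'I_s}) (f : 'I_#|S| -> V)
    (j : 'I_s) : V :=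
  oapp f 0 [pick l | enum_val l == j].

Lemma scatter_enum_val (V : nmodType) (s : nat) (S : {set 'I_s})
    (f : 'I_#|S| -> V) l : scatter f (enum_val l) = f l.
Proof.
rewrite /scatter; case: pickP => [k /eqP /enum_val_inj -> //|/(_ l)].
by rewrite eqxx.
Qed.

Lemma scatter_notin (V : nmodType) (s : nat) (S : {set 'I_s})
    (f : 'I_#|S| -> V) j : j \notin S -> scatter f j = 0.
Proof.
move=> jS; rewrite /scatter; case: pickP => //= l /eqP lj.
by rewrite -lj enum_valP in jS.
Qed.

Lemma sum_weyl_sq_append (R : realType) (n q s : nat) (F : 'I_q -> rpoly R n)
    (G : 'I_s -> rpoly R n) (S : {set 'I_s}) :
  \sum_k weyl_sq (append F G S k)
  = \sum_i weyl_sq (F i) + \sum_(j in S) weyl_sq (G j).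
Proof.
rewrite big_split_ord /= [\sum_(j in S) _]big_enum_val.
by congr (_ + _); apply: eq_bigr => i _; rewrite ?append_lshift ?append_rshift.
Qed.

Lemma weyl_norm_append (R : realType) (n q s : nat) (F : 'I_q -> rpoly R n)
    (G : 'I_s -> rpoly R n) (S : {set 'I_s}) :
  weyl_norm (append F G S) <= weyl_norm2 F G.
Proof.
rewrite /weyl_norm /weyl_norm2 sum_weyl_sq_append ler_wsqrtr // lerD2l.
rewrite [leRHS](bigID (mem S)) /= lerDl.
by apply: sumr_ge0 => j _; apply: weyl_sq_ge0.
Qed.

Lemma kappa_star_ge (R : realType) (n q s : nat)
    (dF : 'I_q -> nat) (dG : 'I_s -> nat) (F : 'I_q -> rpoly R n)
    (G : 'I_s -> rpoly R n) (S : {set 'I_s}) (x : 'cV[R]_n.+1) :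
  (q + #|S| <= n.+1)%N -> enorm x = 1 ->
  (kappa_at (append dF dG S) (append F G S) x <= kappa_star dF dG F G)%E.
Proof.
move=> hS x1; apply: (@le_trans _ _ (kappa (append dF dG S) (append F G S))).
  by apply: ereal_sup_ubound; exists x.
by apply: ereal_sup_ubound; exists S.
Qed.

Lemma dist_Sigma_star_ge0 (R : realType) (n q s : nat)
    (dF : 'I_q -> nat) (dG : 'I_s -> nat) (F : 'I_q -> rpoly R n)
    (G : 'I_s -> rpoly R n) : 0 <= dist_Sigma_star dF dG F G.
Proof.
rewrite /dist_Sigma_star; set A := (X in inf X).
have [->|A0] := eqVneq A classical_sets.set0; first by rewrite inf0.
apply: lb_le_inf; first exact/set0P.
by move=> _ [FG _ <-]; apply: sqrtr_ge0.
Qed.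

(** Extended by zero, [p] perturbs the whole pair at the same Weyl norm, and a single subtuple and
    point of infinite condition put the result in Sigma_*. *)
Lemma dist_Sigma_star_le (R : realType) (n q s : nat)
    (dF : 'I_q -> nat) (dG : 'I_s -> nat) (F : 'I_q -> rpoly R n)
    (G : 'I_s -> rpoly R n) (S : {set 'I_s}) (x : 'cV[R]_n.+1)
    (p : 'I_(q + #|S|) -> rpoly R n) :
  in_H dF F -> in_H dG G -> (q + #|S| <= n.+1)%N -> enorm x = 1 ->
  in_H (append dF dG S) p ->
  kappa_at (append dF dG S) (fun k => append F G S k - p k) x = +oo%E ->
  dist_Sigma_star dF dG F G ^+ 2 <= \sum_k weyl_sq (p k).
Proof.
move=> hF hG hS x1 hp kp.
pose pF i := p (lshift #|S| i); pose pG := scatter (fun l => p (rshift q l)).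
have pE : append pF pG S = p.
  apply: funext => k; rewrite -[k]splitK.
  case: (split k) => l /=; first by rewrite append_lshift.
  by rewrite append_rshift /pG scatter_enum_val.
have sumE : \sum_i weyl_sq (pF i) + \sum_j weyl_sq (pG j) = \sum_k weyl_sq (p k).
  rewrite -[in RHS]pE sum_weyl_sq_append; congr (_ + _).
  rewrite (bigID (mem S)) /= [X in _ + X]big1 ?addr0 // => j jS.
  by rewrite /pG scatter_notin // weyl_sq0.
have le_dist : dist_Sigma_star dF dG F G <= weyl_norm2 pF pG.
  apply: ge_inf; first by exists 0 => _ [FG _ <-]; apply: sqrtr_ge0.
  exists (fun i => F i - pF i, fun j => G j - pG j); last first.
    by congr weyl_norm2; apply: funext => i /=; rewrite opprB addrC subrK.
  split; [|split].
  - move=> i; apply: rpredB; first exact: hF.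
    by have := hp (lshift _ i); rewrite append_lshift.
  - move=> j; apply: rpredB; first exact: hG.
    have [jS|jS] := boolP (j \in S); last by rewrite /pG scatter_notin ?rpred0.
    have := hp (rshift _ (enum_rank_in jS j)).
    rewrite append_rshift enum_rankK_in // => hj.
    by rewrite -[j](enum_rankK_in jS jS) /pG scatter_enum_val enum_rankK_in.
  apply/eqP; rewrite -leye_eq -kp.
  apply: le_trans (kappa_star_ge _ _ _ _ hS x1).
  rewrite le_eqVlt; apply/orP; left; apply/eqP.
  congr kappa_at; apply: funext => k; rewrite -[in p k]pE -[k]splitK.
  by case: (split k) => l /=; rewrite ?append_lshift ?append_rshift.
rewrite -sumE; apply: le_trans (lerXn2r 2 _ _ le_dist) _.
- by rewrite nnegrE dist_Sigma_star_ge0.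
- by rewrite nnegrE sqrtr_ge0.
rewrite sqr_sqrtr // addr_ge0 //.
  by apply: sumr_ge0 => i _; apply: weyl_sq_ge0.
by apply: sumr_ge0 => j _; apply: weyl_sq_ge0.
Qed.

(** * Operator norm and the condition number at one point *)

Lemma opnorm_le (R : realType) (k l : nat) (M : 'M[R]_(k, l)) (t : R) :
  (forall w, enorm w <= 1 -> enorm (M *m w) <= t) -> opnorm M <= t.
Proof.
move=> hM; rewrite /opnorm; apply: sup_le_ub; last first.
  by move=> _ [w w1 <-]; apply: hM.
by exists (enorm (M *m 0)), 0 => //=; rewrite enormE dot0l sqrtr0.
Qed.

Lemma opnorm_ge0 (R : realType) (k l : nat) (M : 'M[R]_(k, l)) :
  0 <= opnorm M.
Proof.
rewrite /opnorm; set A := (X in sup X).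
(* On a set with no supremum [sup] takes the default value 0. *)
have [supA|/sup_out -> //] := pselect (has_sup A).
apply: sup_upper_bound => //; exists 0; first by rewrite /= enormE dot0l sqrtr0.
by rewrite mulmx0 enormE dot0l sqrtr0.
Qed.

Lemma einv_esqrt_le (R : realType) (a : R) (e : \bar R) :
  0 < a -> ((a ^+ 2)%:E <= e)%E -> (einv (esqrt e) <= (a^-1)%:E)%E.
Proof.
move=> a0; case: e => [t||] //=; last first.
  by move=> _; rewrite lee_fin invr_ge0 ltW.
rewrite lee_fin => at2; have le_at : a <= Num.sqrt t.
  by rewrite -[a](gtr0_norm a0) -sqrtr_sqr ler_wsqrtr.
have t0 : 0 < Num.sqrt t := lt_le_trans a0 le_at.
by rewrite gt_eqF // lee_fin lef_pV2.
Qed.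

(** With M = A^dagger Delta and r > |F(x)|, the bounds for the separate z read |M z| <= (r^2 -
    |F(x)|^2)^(-1/2); the supremum over z then bounds the operator norm, with no maximiser
    chosen. *)
Lemma kappa_at_le (R : realType) (n m : nat) (d : 'I_m -> nat)
    (F : 'I_m -> rpoly R n) (x : 'cV[R]_n.+1) (r : R) :
  0 < r -> 0 < weyl_norm F -> ~ (forall i, F i = 0) ->
  (~ restr_surj F x -> r ^+ 2 <= enorm (evalF F x) ^+ 2) ->
  (restr_surj F x -> forall z, enorm z <= 1 ->
     0 < enorm (pinv_Delta d F x *m z) ->
     r ^+ 2 <= enorm (evalF F x) ^+ 2 + enorm (pinv_Delta d F x *m z) ^- 2) ->
  (kappa_at d F x <= (weyl_norm F / r)%:E)%E.
Proof.
set N := weyl_norm F; set c := enorm _ => r0 N0 nzF r_nsurj r_surj.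
rewrite /kappa_at asboolF // -/N -/c -[_ / r]invf_div.
apply: einv_esqrt_le; first exact: divr_gt0.
rewrite expr_div_n /mu_proj; case: ifP => [/asboolP surj|/asboolP nsurj]; last first.
  rewrite /= -EFinM -EFinD lee_fin mul0r add0r ler_pM2r ?invr_gt0 ?exprn_gt0 //.
  exact: r_nsurj.
have {r_nsurj} := r_surj surj; set M := pinv_Delta _ _ _ => r_le.
(* If [mu_proj] is 0, its inverse is +oo by convention and the bound is trivial. *)
rewrite -/N /=; case: eqP => [_|/eqP]; first by rewrite mulyy leey.
rewrite mulf_eq0 negb_or => /andP[_ M0].
have {}M0 : 0 < opnorm M by rewrite lt_neqAle eq_sym M0 opnorm_ge0.
rewrite -EFinM -EFinD lee_fin -expr2 exprVn exprMn.
rewrite [(_ * opnorm M ^+ 2)^-1]invfM [N ^- 2 * _]mulrC -mulrDl.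
rewrite ler_pM2r ?invr_gt0 ?exprn_gt0 // -lerBlDr.
(* For r <= |F(x)| the bound is immediate; otherwise the square root below is that of a positive
   number. *)
have [rc|rc] := leP (r ^+ 2 - c ^+ 2) 0.
  by apply: le_trans rc _; rewrite invr_ge0 exprn_ge0 // ltW.
have : opnorm M <= Num.sqrt (r ^+ 2 - c ^+ 2)^-1.
  apply: opnorm_le => z z1; have [Mz|] := ltP 0 (enorm (M *m z)); last first.
    by move=> Mz; apply: le_trans Mz _; apply: sqrtr_ge0.
  rewrite -[leLHS]gtr0_norm // -sqrtr_sqr ler_wsqrtr // -[leLHS]invrK.
  rewrite lef_pV2 ?posrE ?invr_gt0 ?exprn_gt0 // lerBlDl.
  exact: r_le.
move=> /(lerXn2r 2); rewrite !nnegrE sqrtr_ge0 (ltW M0) => /(_ isT isT).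
rewrite sqr_sqrtr ?invr_ge0 ?(ltW rc) // => le_M.
by rewrite -[leLHS]invrK lef_pV2 ?posrE ?exprn_gt0 ?invr_gt0.
Qed.

(** * Passage to the supremum over subtuples and points *)

Theorem theorem4p10 (R : realType) (n q s : nat)
  (dF : 'I_q -> nat) (dG : 'I_s -> nat)
  (F : 'I_q -> rpoly R n) (G : 'I_s -> rpoly R n) :
  (q <= n.+1)%N ->
  in_H dF F -> in_H dG G ->
  ~ ((forall i, F i = 0) /\ (forall j, G j = 0)) ->
  (kappa_star dF dG F G
     <= eratio (weyl_norm2 F G) (dist_Sigma_star dF dG F G))%E.
Proof.
(* At distance 0 the ratio is +oo by convention. *)
move=> _ hF hG _; rewrite /eratio; case: eqP => [_|/eqP r_neq0].
  by rewrite leey.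
set r := dist_Sigma_star _ _ _ _ in r_neq0 *.
have r0 : 0 < r by rewrite lt_neqAle eq_sym r_neq0 dist_Sigma_star_ge0.
apply: ge_ereal_sup => _ [S /= hS <-]; apply: ge_ereal_sup => _ [x /= x1 <-].
set H := append F G S; set d := append dF dG S.
have hH : in_H d H.
  move=> k; rewrite /H /d -[k]splitK.
  by case: (split k) => l /=; rewrite ?append_lshift ?append_rshift.
have r_le p : in_H d p -> kappa_at d (fun k => H k - p k) x = +oo%E ->
    r ^+ 2 <= \sum_k weyl_sq (p k) by exact: dist_Sigma_star_le.
have dx1 : dot x x = 1 by rewrite -sqr_enorm x1 expr1n.
(* Taking p = H leaves the zero tuple, whose condition number is infinite, so 0 < r^2 <= |H|^2. *)
have N0 : 0 < weyl_norm H.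
  rewrite sqrtr_gt0; apply: lt_le_trans (r_le _ hH _); first exact: exprn_gt0.
  by rewrite /kappa_at asboolT // => k; rewrite subrr.
have nzH : ~ (forall k, H k = 0).
  move=> H0; move: N0; rewrite /weyl_norm big1 ?sqrtr0 ?ltxx // => k _.
  by rewrite H0 weyl_sq0.
apply: (@le_trans _ _ (weyl_norm H / r)%:E); last first.
  by rewrite lee_fin ler_pM2r ?invr_gt0 // weyl_norm_append.
apply: kappa_at_le => // [nsurj|surj z z1 Mz].
  have [p [hp kp]] := singular_perturbation_degenerate d dx1 nsurj.
  by apply: le_trans; apply: r_le.
have [p [hp kp]] := singular_perturbation dx1 surj z1 Mz.
by apply: le_trans; apply: r_le.
Qed.
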